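(* Let $P:\mathbb{H}\setminus\mathbb{R}\to\mathbb{H}$ be a slice-polynomial function which is not slice-constant, let $P^\vee$ be its companion, $P_{\mathbb{R}}:\mathbb{S}\times\mathbb{R}\to\mathbb{H}$ its extension to the real axis, and $d$ its twistor degree. Then, for generic $q\in\mathbb{H}$, i.e. for all $q$ outside a (proper) real Zariski closed subset of $\mathbb{H}\cong\mathbb{R}^4$, $$\#\{P^{-1}(q)\}+\#\{(P^\vee)^{-1}(q)\}+\#\{P_{\mathbb{R}}^{-1}(q)\}=d .$$
   Context: Let $\mathbb{H}$ be the quaternions with standard basis $1,i,j,k$ and $\mathbb{S}=\{q\in\mathbb{H}: q^2=-1\}$. For $I\in\mathbb{S}$ put $\mathbb{C}_I=\mathbb{R}+\mathbb{R}I$ and $\mathbb{C}_I^{\pm}=\{\alpha+I\beta:\ \pm\beta>0\}$. Slice regular functions. Let $D\subseteq\mathbb{C}$ be open with $\overline D=D$ (complex conjugation) and $\Omega_D=\{\alpha+I\beta:\ \alpha+i\beta\in D,\ I\in\mathbb{S}\}$ (a circular domain). A stem function is $F=F_1+\imath F_2:D\to\mathbb{H}\otimes\mathbb{C}$ ($F_1,F_2$ quaternion valued, $\imath$ the central imaginary unit of the factor $\mathbb{C}$) with $F(\bar z)=\overline{F(z)}:=F_1(z)-\imath F_2(z)$. It induces the slice function $f=\mathcal{I}(F):\Omega_D\to\mathbb{H}$, $f(\alpha+I\beta)=F_1(\alpha+i\beta)+IF_2(\alpha+i\beta)$. $f$ is slice regular if $F$ is holomorphic (with respect to multiplication by $\imath$);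 $f$ is slice-constant if $F$ is locally constant. The $*$-product is $\mathcal{I}(F)*\mathcal{I}(G)=\mathcal{I}(FG)$. A slice regular function $P:\mathbb{H}\setminus\mathbb{R}\to\mathbb{H}$ is a slice-polynomial function if for every $I\in\mathbb{S}$ the restriction of $P$ to $\mathbb{C}_I^+$ is a polynomial $v\mapsto\sum_n v^n c_n$ with $c_n\in\mathbb{H}$ (depending on $I$). Companion. Let $\ell_+(\alpha+I\beta)=\frac{1-Ii}{2}$ and $\ell_-(\alpha+I\beta)=\frac{1+Ii}{2}$ for $I\in\mathbb{S}$, $\beta>0$. A slice-polynomial function can be written uniquely as $P=P_+*\ell_++P_-*\ell_-$ with quaternionic polynomials $P_\pm(q)=\sum_n q^n a_n^\pm$, $a_n^\pm\in\mathbb{H}$; its companion is $P^\vee=P_-*\ell_++P_+*\ell_-$. Extension to the real axis. $P_{\mathbb{R}}:\mathbb{S}\times\mathbb{R}\to\mathbb{H}$, $P_{\mathbb{R}}(I,\alpha)=\lim_{\beta\to0^+}P(\alpha+I\beta)$; thus $P_{\mathbb{R}}^{-1}(q)\subseteq\mathbb{S}\times\mathbb{R}$. Twistor degree. There are unique polynomials $g,h,\hat g,\hat h$ with coefficients in $\mathbb{C}_i$ such that $P(v)=g(v)+h(v)j$ for $v\in\mathbb{C}_i^+$ and $P(v)=\overline{\hat g(\bar v)}+\overline{\hat h(\bar v)}\,j$ for $v\in\mathbb{C}_i^-$. For $q=q_1+q_2j$ with $q_1,q_2\in\mathbb{C}_i$ let $$D_q(v)=-(g(v)-q_1)(\bar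 q_1-\hat g(v))+(h(v)-q_2)(\hat h(v)-\bar q_2),$$ a polynomial in $v\in\mathbb{C}_i$. The twistor degree of $P$ is $d=\max_{q\in\mathbb{H}}\deg D_q$. *)

(* Defs.v *)
From HB Require Import structures.
From mathcomp Require Import all_boot all_order all_algebra.
From mathcomp Require Import complex.
From mathcomp Require Import all_classical all_reals all_analysis.
(* The notations of mpoly clash with those of MathComp-Analysis. *)
From mathcomp Require Import -(notations) mpoly.
From mathcomp Require Import ring.

Set Implicit Arguments.
Unset Strict Implicit.
Unset Printing Implicit Defensive.

Import Order.TTheory GRing.Theory Num.Theory numFieldNormedType.Exports.

Local Open Scope ring_scope.
Local Open Scope complex_scope.
Local Open Scope classical_set_scope.

(* The Hamilton quaternion algebra over a commutative ring K, in the basis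
   1, i, j, k.  For K = R it is H; for K = R[i] it is H (x) C, the central
   imaginary unit being 'i%:A. *)
Definition quat (K : Type) := 'rV[K]_4.

HB.instance Definition _ (K : choiceType) := Choice.copy (quat K) 'rV[K]_4.
HB.instance Definition _ (K : pzRingType) :=
  GRing.Lmodule.copy (quat K) 'rV[K]_4.
HB.instance Definition _ (K : numFieldType) :=
  NormedModule.copy (quat K) 'rV[K]_4.

Definition mkq (K : Type) (a b c d : K) : quat K :=
  \row_(k < 4) nth a [:: a; b; c; d] k.

Section QuaternionRing.
Variable K : comNzRingType.
Implicit Types x y z : quat K.

Definition qcoord x (n : nat) : K := x 0 (inord n).

Definition qone : quat K := mkq 1 0 0 0.

Definition qmul x y : quat K :=
  let x0 := qcoord x 0 in let x1 := qcoord x 1 in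
  let x2 := qcoord x 2 in let x3 := qcoord x 3 in
  let y0 := qcoord y 0 in let y1 := qcoord y 1 in
  let y2 := qcoord y 2 in let y3 := qcoord y 3 in
  mkq (x0 * y0 - x1 * y1 - x2 * y2 - x3 * y3)
      (x0 * y1 + x1 * y0 + x2 * y3 - x3 * y2)
      (x0 * y2 - x1 * y3 + x2 * y0 + x3 * y1)
      (x0 * y3 + x1 * y2 - x2 * y1 + x3 * y0).

Lemma qcoord_mkq (a b c d : K) :
  (qcoord (mkq a b c d) 0 = a) * (qcoord (mkq a b c d) 1 = b) *
  (qcoord (mkq a b c d) 2 = c) * (qcoord (mkq a b c d) 3 = d).
Proof. by rewrite /qcoord /mkq !mxE !inordK. Qed.

Lemma qcoordD x y n : qcoord (x + y) n = qcoord x n + qcoord y n.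
Proof. by rewrite /qcoord mxE. Qed.

Lemma qcoordZ (a : K) x n : qcoord (a *: x) n = a * qcoord x n.
Proof. by rewrite /qcoord mxE. Qed.

Lemma quatP x y :
  [/\ qcoord x 0 = qcoord y 0, qcoord x 1 = qcoord y 1,
      qcoord x 2 = qcoord y 2 & qcoord x 3 = qcoord y 3] -> x = y.
Proof.
move=> [h0 h1 h2 h3]; apply/rowP => k; rewrite -(inord_val k).
by case: k => [[|[|[|[|//]]]]].
Qed.

Fact qmulA : associative qmul.
Proof. by move=> x y z; apply: quatP; rewrite !qcoord_mkq; split; ring. Qed.

Fact qmul1 : left_id qone qmul.
Proof. by move=> x; apply: quatP; rewrite !qcoord_mkq; split; ring. Qed.

Fact qmulr1 : right_id qone qmul.
Proof. by move=> x; apply: quatP; rewrite !qcoord_mkq; split; ring. Qed.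

Fact qmulDl : left_distributive qmul +%R.
Proof.
by move=> x y z; apply: quatP; rewrite !(qcoordD, qcoord_mkq); split; ring.
Qed.

Fact qmulDr : right_distributive qmul +%R.
Proof.
by move=> x y z; apply: quatP; rewrite !(qcoordD, qcoord_mkq); split; ring.
Qed.

Fact qone_neq0 : qone != 0.
Proof.
apply/eqP => /(congr1 (qcoord^~ 0)); rewrite qcoord_mkq /qcoord mxE.
by apply/eqP; rewrite oner_eq0.
Qed.

HB.instance Definition _ := GRing.Zmodule_isNzRing.Build (quat K)
  qmulA qmul1 qmulr1 qmulDl qmulDr qone_neq0.

Fact qscaleAl (a : K) x y : a *: (x * y) = (a *: x) * y.
Proof. by apply: quatP; rewrite !(qcoordZ, qcoord_mkq); split; ring. Qed.

HB.instance Definition _ := GRing.Lmodule_isLalgebra.Build K (quat K) qscaleAl.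

Fact qscaleAr (a : K) x y : a *: (x * y) = x * (a *: y).
Proof. by apply: quatP; rewrite !(qcoordZ, qcoord_mkq); split; ring. Qed.

HB.instance Definition _ := GRing.Lalgebra_isAlgebra.Build K (quat K) qscaleAr.

Definition qi : quat K := mkq 0 1 0 0.
Definition qj : quat K := mkq 0 0 1 0.
Definition qk : quat K := mkq 0 0 0 1.

End QuaternionRing.

Arguments qi {K}.
Arguments qj {K}.
Arguments qk {K}.

Section SliceFunctions.
Variable R : realType.
Notation C := R[i].
Notation H := (quat R).
Notation HC := (quat R[i]).
Implicit Types (I : H) (z : C) (D : set C) (F : C -> HC) (f : H -> H).

Definition complexify (x : H) : HC := map_mx (real_complex R) x.
Definition HRe (w : HC) : H := map_mx (@complex.Re R) w.
Definition HIm (w : HC) : H := map_mx (@complex.Im R) w.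
Definition HCconj (w : HC) : HC := map_mx (@conjc R) w.

Definition unit_sphere : set H := [set q | q ^+ 2 = -1].

Definition real_axis : set H := range (fun a : R => a%:A).

(* alpha + i beta |-> alpha + I beta *)
Definition to_slice I z : H := (complex.Re z)%:A + complex.Im z *: I.

Definition is_stem D F := forall z, D z -> F z^* = HCconj (F z).

Definition slice_value I (w : HC) : H := HRe w + I * HIm w.

(* f is the slice function I(F); domains D are stable under conjugation, and
   values of F outside D and of f outside Omega_D are irrelevant. *)
Definition induces D F f := forall I z, unit_sphere I -> D z ->
  f (to_slice I z) = slice_value I (F z).

(* Complex differentiability; scaling by 'i on HC is multiplication by the
   central imaginary unit. *)
Definition holomorphic_on D F := forall z, D z ->
  derivable (F : C^o -> HC) z 1.

Definition locally_constant_on D F := forall z, D z ->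
  \forall w \near (z : C^o), F w = F z.

Definition slice_regular D f :=
  exists F, [/\ is_stem D F, holomorphic_on D F & induces D F f].

Definition slice_constant D f :=
  exists F, [/\ is_stem D F, locally_constant_on D F & induces D F f].

(* Omega_D = H \ R for this D. *)
Definition nonreal : set C := [set z | complex.Im z != 0].

(* Coefficients are on the right, unlike in Horner evaluation of {poly H}. *)
Definition reval (c : {poly H}) (v : H) : H :=
  \sum_(n < size c) v ^+ n * c`_n.

Definition slice_polynomial (P : H -> H) :=
  slice_regular nonreal P /\
  forall I, unit_sphere I -> exists c : {poly H},
    forall z, 0 < complex.Im z -> P (to_slice I z) = reval c (to_slice I z).

(* Stem functions of q |-> \sum_n q^n a_n and of l_+, l_-; the values of the
   latter two on the lower half plane are forced by the stem condition. *)
Definition poly_stem (a : {poly H}) z : HC :=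
  \sum_(n < size a) z ^+ n *: complexify a`_n.

Definition ellp_stem z : HC :=
  (2^-1)%:C *: (if 0 < complex.Im z then 1 - 'i *: qi else 1 + 'i *: qi).

Definition ellm_stem z : HC :=
  (2^-1)%:C *: (if 0 < complex.Im z then 1 + 'i *: qi else 1 - 'i *: qi).

Lemma slice_valueD I w1 w2 :
  slice_value I (w1 + w2) = slice_value I w1 + slice_value I w2.
Proof.
have hR : HRe (w1 + w2) = HRe w1 + HRe w2.
  by apply/rowP => k; rewrite !mxE; case: (w1 0 k) (w2 0 k) => [? ?] [].
have hI : HIm (w1 + w2) = HIm w1 + HIm w2.
  by apply/rowP => k; rewrite !mxE; case: (w1 0 k) (w2 0 k) => [? ?] [].
by rewrite /slice_value hR hI mulrDr addrACA.
Qed.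

Lemma slice_valueZ I z w : unit_sphere I ->
  slice_value I (z *: w) = to_slice I z * slice_value I w.
Proof.
rewrite /unit_sphere /= expr2 /slice_value /to_slice => I2; case: z => a b /=.
have -> : HRe ((a +i* b) *: w) = a *: HRe w - b *: HIm w.
  by apply/rowP => k; rewrite !mxE; case: (w 0 k).
have -> : HIm ((a +i* b) *: w) = a *: HIm w + b *: HRe w.
  by apply/rowP => k; rewrite !mxE; case: (w 0 k) => x y /=.
rewrite mulrDl !mulrDr -!scalerAl !mul1r -!scalerAr (mulrA I I) I2 mulN1r.
by rewrite scalerN -!addrA; congr (_ + _); rewrite addrC addrA.
Qed.

Lemma slice_value_complexify I x : slice_value I (complexify x) = x.
Proof.
have hR : HRe (complexify x) = x by apply/rowP => k; rewrite !mxE.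
have hI : HIm (complexify x) = 0 by apply/rowP => k; rewrite !mxE.
by rewrite /slice_value hR hI mulr0 addr0.
Qed.

Lemma to_slice_real I a : to_slice I a%:C = a%:A.
Proof. by rewrite /to_slice /= scale0r addr0. Qed.

Lemma to_slice_i I : to_slice I 'i = I.
Proof. by rewrite /to_slice /= scale0r add0r scale1r. Qed.

Lemma to_sliceM I z w : unit_sphere I ->
  to_slice I (z * w) = to_slice I z * to_slice I w.
Proof.
rewrite /unit_sphere /= expr2 /to_slice => I2; case: z w => a b [c d] /=.
rewrite mulrDl !mulrDr -!scalerAl !mul1r -!scalerAr I2 !scalerA scalerN mulr1.
rewrite !(scalerBl, scalerDl) -!addrA; congr (_ + _).
by rewrite addrC addrA.
Qed.

Lemma to_sliceX I z n : unit_sphere I ->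
  to_slice I (z ^+ n) = to_slice I z ^+ n.
Proof.
move=> SI; elim: n => [|n IHn].
  by rewrite -[z ^+ 0]/(1%:C) to_slice_real scale1r.
by rewrite !exprS to_sliceM // IHn.
Qed.

Lemma poly_stem_induces D a : induces D (poly_stem a) (reval a).
Proof.
move=> I z SI _; rewrite /poly_stem /reval.
have v0 : slice_value I 0 = 0.
  by apply: (addrI (slice_value I 0)); rewrite -slice_valueD !addr0.
rewrite (big_morph (slice_value I) (slice_valueD I) v0).
apply: eq_bigr => n _.
by rewrite slice_valueZ // slice_value_complexify to_sliceX.
Qed.

Lemma complexify1 : complexify 1 = 1.
Proof.
apply/rowP => k; rewrite !mxE.
by case: k => [[|[|[|[|//]]]]] ?; rewrite /= ?rmorph1 ?rmorph0.
Qed.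

Lemma complexify_qi : complexify qi = qi.
Proof.
apply/rowP => k; rewrite !mxE.
by case: k => [[|[|[|[|//]]]]] ?; rewrite /= ?rmorph1 ?rmorph0.
Qed.

Lemma ellp_stem_upper I z : unit_sphere I -> 0 < complex.Im z ->
  slice_value I (ellp_stem z) = 2^-1 *: (1 - I * qi).
Proof.
move=> SI z0; rewrite /ellp_stem z0 slice_valueZ // to_slice_real.
rewrite -scalerAl mul1r.
congr (_ *: _); rewrite -scaleN1r scalerA mulN1r slice_valueD slice_valueZ //.
rewrite -complexify1 -complexify_qi !slice_value_complexify; congr (_ + _).
by rewrite /to_slice /= oppr0 scale0r add0r scaleN1r mulNr.
Qed.

Lemma ellm_stem_upper I z : unit_sphere I -> 0 < complex.Im z ->
  slice_value I (ellm_stem z) = 2^-1 *: (1 + I * qi).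
Proof.
move=> SI z0; rewrite /ellm_stem z0 slice_valueZ // to_slice_real.
rewrite -scalerAl mul1r.
congr (_ *: _); rewrite slice_valueD slice_valueZ //.
by rewrite -complexify1 -complexify_qi !slice_value_complexify to_slice_i.
Qed.

Lemma ell_is_stem : is_stem nonreal ellp_stem /\ is_stem nonreal ellm_stem.
Proof.
have P1 (z : C) : nonreal z ->
  (0 < complex.Im z /\ (0 < complex.Im z^* = false)) \/
  ((0 < complex.Im z = false) /\ 0 < complex.Im z^*).
  case: z => x y; rewrite /nonreal /= oppr_gt0 => y0.
  by move: y0; case: ltgtP => //= _ _; auto.
have P2 b : HCconj ((2^-1)%:C *: (if b then 1 - 'i *: qi else 1 + 'i *: qi)) =
   (2^-1)%:C *: (if b then 1 + 'i *: qi else 1 - 'i *: qi).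
  apply/rowP => k; rewrite !mxE.
  by case: b; rewrite !mxE;
     case: k => [[|[|[|[|//]]]]] ?; rewrite /=; simpc; rewrite /= ?oppr0 ?opprK.
have HK w : HCconj (HCconj w) = w.
  by apply/rowP => k; rewrite !mxE conjcK.
split=> z /P1 [[z1 z2]|[z1 z2]]; rewrite /ellp_stem /ellm_stem ?z1 ?z2.
- by rewrite (P2 true).
- by rewrite (P2 false).
- by rewrite -(P2 true) HK.
- by rewrite -(P2 false) HK.
Qed.

(* P = P_+ * l_+ + P_- * l_-, where P_+ and P_- have coefficients a and b; the
   star product is induced by the pointwise product of stem functions. *)
Definition slice_decomposition (a b : {poly H}) (P : H -> H) :=
  induces nonreal
    (fun z => poly_stem a z * ellp_stem z + poly_stem b z * ellm_stem z) P.

Definition is_companion (P Pv : H -> H) := exists a b : {poly H},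
  slice_decomposition a b P /\ slice_decomposition b a Pv.

Definition real_extension (P : H -> H) (I : H) (alpha : R) : H :=
  lim (P (alpha%:A + beta *: I) @[beta --> 0^'+]).

Definition fiber (P : H -> H) (q : H) : set H :=
  [set x | ~ real_axis x /\ P x = q].

Definition real_fiber (P : H -> H) (q : H) : set (H * R) :=
  [set x | unit_sphere x.1 /\ real_extension P x.1 x.2 = q].

(* The C_i-components of q = q_1 + q_2 j. *)
Definition qfst (q : H) : C := qcoord q 0 +i* qcoord q 1.
Definition qsnd (q : H) : C := qcoord q 2 +i* qcoord q 3.

Definition twistor_polys (P : H -> H) (g h gh hh : {poly C}) :=
  (forall z, 0 < complex.Im z ->
     P (to_slice qi z) = to_slice qi g.[z] + to_slice qi h.[z] * qj) /\
  (forall z, complex.Im z < 0 ->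
     P (to_slice qi z) =
       to_slice qi (gh.[z^*]^*) + to_slice qi (hh.[z^*]^*) * qj).

Definition twistor_poly (g h gh hh : {poly C}) (q : H) : {poly C} :=
  - (g - (qfst q)%:P) * ((qfst q)^*%:P - gh)
  + (h - (qsnd q)%:P) * (hh - (qsnd q)^*%:P).

Definition is_twistor_degree (P : H -> H) (d : nat) :=
  exists g h gh hh : {poly C},
    [/\ twistor_polys P g h gh hh,
        exists q, (size (twistor_poly g h gh hh q)).-1 = d
      & forall q, ((size (twistor_poly g h gh hh q)).-1 <= d)%N].

Definition real_zariski_closed (Z : set H) :=
  exists S : set (mpoly 4 R), Z = [set q | forall p, S p -> meval (q 0) p = 0].

End SliceFunctions.

(* Main.v *)
Require Import Defs.
From mathcomp Require Import all_boot all_order all_algebra all_field.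
From mathcomp Require Import complex.
From mathcomp Require Import all_classical all_reals all_analysis.
From mathcomp Require Import -(notations) mpoly.
From mathcomp Require Import ring lra.

Set Implicit Arguments.
Unset Strict Implicit.
Unset Printing Implicit Defensive.

Import Order.TTheory GRing.Theory Num.Theory numFieldNormedType.Exports.

Local Open Scope ring_scope.

(** Write $F = a l_+ + b l_-$ for the stem function of $P$.  On the upper half
plane the idempotents $l_{\pm}$ are the constants $(1 \mp \imath i)/2$, so there
$F$ is the restriction of a map $W : C \to H \otimes C$ with polynomial
coordinates ([upper_stem]).  On the lower half plane $l_+$ and $l_-$ are
exchanged, so there the same $W$ is the stem function of the companion, and by
continuity $P_R(I, \alpha)$ is the slice value of $W(\alpha)$ at $I$
([decomposition_upper], [decomposition_lower], [real_extensionE]).  Hence the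
three fibres over $q$ are the solutions $(I, z)$ of one equation, that the slice
value of $W(z) - q$ at $I$ vanishes, with $z$ in the upper half plane, in the
lower half plane, and on the real line.

For $w = u + \imath v$ in $H \otimes C$ the equation $u + I v = 0$ with $I$ in
the sphere forces $|u| = |v|$ and $u \perp v$; that is, the complexified norm
$N(w) = \sum_k w_k^2$ vanishes.  Conversely, if $N(w) = 0$ and $w \neq 0$ there
is exactly one such $I$, namely $- u v^{-1}$ ([slice_zero_exists],
[slice_zero_unique]).  The polynomial $D_q$ is precisely $z \mapsto N(W(z) - q)$
([horner_twistor_poly]).  As $N$ is quadratic, $W(z) = q$ makes $z$ a double root
of $D_q$.  So when $D_q$ has only simple roots, each root carries exactly one
point of exactly one of the three fibres, and the total count is $\deg D_q$
([fiber_cardinals]).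

It remains that $D_q$ has degree $d$ and simple roots for generic $q$.  Both are
implied by the nonvanishing of one polynomial in $q$, the product of the leading
coefficient and the resultant of $D_q$ and $D_q'$ ([generic_quadric_separable]).
A polynomial that is nonzero at some complex point is nonzero at some real one,
so $q_1, \bar q_1, q_2, \bar q_2$ may be replaced by independent complex numbers
$x_1, y_1, x_2, y_2$, and $D_q$ by
$(g - x_1)(\hat g - y_1) + (h - x_2)(\hat h - y_2)$.  As $x_1$ varies this is a
pencil $S - x_1 T$ with $T = \hat g - y_1$, and $S$, $T$ are coprime for generic
$y_1, x_2, y_2$.  A double root $v$ of a member of such a pencil is a zero of the
Wronskian $S' T - S T'$, and it determines $x_1 = S(v)/T(v)$; so only finitely
many members have one ([pencil_generic_separable]).

The degree $d$ is positive because a constant $D_q$ for all $q$ would make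
$g, h, \hat g, \hat h$, hence $W$, constant ([twistor_degree_gt0]). *)

(** * Pencils of polynomials *)

Lemma size_deriv_numDomain (F : numDomainType) (p : {poly F}) :
  size p^`() = (size p).-1.
Proof.
have [sp|sp] := leqP (size p) 1.
  by rewrite (size1_polyC sp) derivC size_poly0 size_polyC; case: (_ != 0).
have sp0 : (0 < size p)%N by exact: ltn_trans sp.
have lt0 : (0 < (size p).-1)%N by rewrite -ltnS prednK.
apply/eqP; rewrite eqn_leq -ltnS (prednK sp0) lt_size_deriv ?andTb -?size_poly_gt0 //.
rewrite -[X in (X <= _)%N](prednK lt0) ltnNge; apply/negP.
move=> /leq_sizeP/(_ _ (leqnn _))/eqP; apply/negP; rewrite coef_deriv (prednK lt0).
by rewrite mulrn_eq0 negb_or -lt0n lt0 -lead_coefE lead_coef_eq0 -size_poly_gt0.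
Qed.

(** If $S' T = S T'$ then, by coprimality, $S$ divides $S'$ and $T$ divides $T'$,
which forces both to be constant in characteristic zero. *)
Lemma pencil_wronskian_neq0 (F : numFieldType) (S T : {poly F}) :
  coprimep S T -> (1 < maxn (size S) (size T))%N ->
  S^`() * T - S * T^`() != 0.
Proof.
move=> co; rewrite leq_max => nc; apply/eqP => /eqP; rewrite subr_eq0 => /eqP e.
have step (A B : {poly F}) : coprimep A B -> A^`() * B = A * B^`() ->
    (size A <= 1)%N.
  move=> cAB eAB; rewrite leqNgt; apply/negP => A1.
  have : (A %| A^`())%R by rewrite -(Gauss_dvdpl _ cAB) eAB dvdp_mulIl.
  move/dvdp_leq; rewrite -size_poly_eq0 size_deriv_numDomain.
  by case: (size A) A1 => [|[|n]] //= _ /(_ isT); rewrite ltnn.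
have sS := step _ _ co e.
have sT : (size T <= 1)%N.
  by apply: (step T S); [rewrite coprimep_sym|rewrite mulrC -e mulrC].
by move: nc; rewrite !ltnNge sS sT.
Qed.

(** The excluded parameters are the values of $S/T$ at the zeros of the
Wronskian: a common zero $v$ of $S - x T$ and $S' - x T'$ is a zero of
$S' T - S T'$, where $T(v) \neq 0$ by coprimality, whence $x = S(v)/T(v)$. *)
Lemma pencil_generic_separable (F : numClosedFieldType) (S T : {poly F}) :
  coprimep S T -> (1 < maxn (size S) (size T))%N ->
  exists2 r : {poly F}, r != 0 &
    forall x, r.[x] != 0 -> separable_poly (S - x *: T).
Proof.
move=> co nc; have W0 := pencil_wronskian_neq0 co nc.
set W := _ - _ in W0; have [rs Wrs] := closed_field_poly_normal W.
exists (\prod_(v <- rs) ('X - (S.[v] / T.[v])%:P)).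
  by rewrite prodf_seq_neq0; apply/allP => v _; rewrite polyXsubC_eq0.
move=> x; apply: contraNT; rewrite unlock => nsep.
have /closed_rootP[v] : size (gcdp (S - x *: T) (S - x *: T)^`()) != 1%N.
  by rewrite size_poly_eq1 gcdp_eqp1.
rewrite root_gcd derivB derivZ !rootE !hornerE => /andP[e1 e2].
have {}e1 : S.[v] = x * T.[v] by apply/eqP; rewrite -subr_eq0.
have {}e2 : S^`().[v] = x * T^`().[v] by apply/eqP; rewrite -subr_eq0.
have Tv : T.[v] != 0.
  apply/negP => /eqP Tv; move/coprimep_root: co => /(_ v).
  by rewrite rootE e1 Tv mulr0 eqxx => /(_ isT).
have : root W v by rewrite rootE /W !hornerE e1 e2; apply/eqP; ring.
rewrite Wrs rootZ ?lead_coef_eq0 // root_prod_XsubC => vrs.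
rewrite horner_prod prodf_seq_eq0; apply/hasP; exists v => //=.
by rewrite !hornerE e1 mulfK // subrr.
Qed.

(** The leading coefficients must survive the morphism because the size of the
Sylvester matrix depends on the degrees. *)
Lemma resultant_map (A B : comNzRingType) (f : {rmorphism A -> B})
    (p q : {poly A}) :
    f (lead_coef p) != 0 -> f (lead_coef q) != 0 ->
  f (resultant p q) = resultant (map_poly f p) (map_poly f q).
Proof.
move=> /size_map_poly_id0 sp /size_map_poly_id0 sq.
rewrite /resultant -det_map_mx.
have castE m n (e : m = n) (M : 'M[B]_m) (N : 'M[B]_n) :
  (forall i j, M i j = N (cast_ord e i) (cast_ord e j)) -> \det M = \det N.
  case: n / e N => N MN; congr (\det _); apply/matrixP => i j.
  by rewrite MN !cast_ord_id.
have e : ((size q).-1 + (size p).-1)%N =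
    ((size (map_poly f q)).-1 + (size (map_poly f p)).-1)%N by rewrite sp sq.
apply: (castE _ _ e) => i j; rewrite mxE !Sylvester_mxE.
case: splitP => k ik; case: splitP => l /=; rewrite ik => kl.
- by rewrite kl rmorphMn coef_map.
- by have := ltn_ord k; rewrite kl sq ltnNge leq_addr.
- by have := ltn_ord l; rewrite -kl sq ltnNge leq_addr.
- by have := kl; rewrite sq => /addnI ->; rewrite rmorphMn coef_map.
Qed.

Lemma nat_nonroot (F : numDomainType) (r : {poly F}) :
  r != 0 -> exists n : nat, r.[n%:R] != 0.
Proof.
move=> r0; apply/not_existsP => vanish.
pose s := [seq n%:R : F | n <- iota 0 (size r)].
suff : (size s < size r)%N by rewrite size_map size_iota ltnn.
apply: max_poly_roots => //.
  by apply/allP => _ /mapP[n _ ->]; apply/negPn/negP => /vanish.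
by rewrite map_inj_uniq ?iota_uniq //; exact: mulrIn (oner_neq0 F).
Qed.

(** A coefficient of a pencil is an affine function of the parameter. *)
Lemma coef_line_neq0 (F : idomainType) (A B : {poly F}) (d : nat) (x : F) :
  (A - x *: B)`_d != 0 ->
  exists2 r : {poly F}, r != 0 & forall y, r.[y] != 0 -> (A - y *: B)`_d != 0.
Proof.
have e y : (A - y *: B)`_d = ((A`_d)%:P - (B`_d)%:P * 'X).[y].
  by rewrite !hornerE coefB coefZ mulrC.
rewrite e => r0; eexists; last by move=> y; rewrite e; exact.
by apply: contraNneq r0 => ->; rewrite horner0.
Qed.

Lemma avoid_values (F : closedFieldType) (T u : {poly F}) : T != 0 ->
  exists2 r : {poly F}, r != 0 &
    forall x v, r.[x] != 0 -> root T v -> u.[v] != x.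
Proof.
move=> T0; have [ts eT] := closed_field_poly_normal T.
exists (\prod_(v <- ts) ('X - (u.[v])%:P)).
  by rewrite prodf_seq_neq0; apply/allP => v _; rewrite polyXsubC_eq0.
move=> x v rx; rewrite eT rootZ ?lead_coef_eq0 // root_prod_XsubC => vts.
apply: contraNneq rx => uvx; rewrite horner_prod prodf_seq_eq0.
by apply/hasP; exists v => //=; rewrite !hornerE uvx subrr.
Qed.

(** * Quadrics that are a sum of two products *)

Section SplitQuadric.
Variables (F : numClosedFieldType) (g h gh hh : {poly F}).

(** The twistor polynomial, with $q_1, \bar q_1, q_2, \bar q_2$ replaced by
independent parameters. *)
Definition split_quadric (x1 y1 x2 y2 : F) : {poly F} :=
  (g - x1%:P) * (gh - y1%:P) + (h - x2%:P) * (hh - y2%:P).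

Lemma coef_split_quadric (x1 y1 x2 y2 : F) n : (0 < n)%N ->
  (split_quadric x1 y1 x2 y2)`_n =
  (g * gh + h * hh)`_n - (g`_n * y1 + gh`_n * x1 + h`_n * y2 + hh`_n * x2).
Proof.
case: n => // n _.
have -> : split_quadric x1 y1 x2 y2 = (g * gh + h * hh)
    - (g * y1%:P + gh * x1%:P + h * y2%:P + hh * x2%:P) + (x1 * y1 + x2 * y2)%:P.
  by rewrite /split_quadric polyCD !polyCM; ring.
by rewrite coefD coefB !coefD coefC /= addr0 !coefMC.
Qed.

Lemma horner_split_quadric (x1 y1 x2 y2 z : F) :
  (split_quadric x1 y1 x2 y2).[z] =
  (g.[z] - x1) * (gh.[z] - y1) + (h.[z] - x2) * (hh.[z] - y2).
Proof. by rewrite /split_quadric !hornerE. Qed.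

(** A point where both factors of both products vanish is a double root. *)
Lemma deriv_split_quadric_eq0 (z : F) :
  (split_quadric g.[z] gh.[z] h.[z] hh.[z])^`().[z] = 0.
Proof.
rewrite /split_quadric derivD !derivM !derivB !derivC.
by rewrite !(hornerD, hornerM, hornerN, hornerC) !subrr !(mulr0, mul0r) !addr0.
Qed.

(** Starting from a point where the coefficient of degree $d$ is nonzero, the
parameters are moved one at a time, keeping that coefficient nonzero:
first $y_1$, so that $T = \hat g - y_1$ is nonzero, then $x_2$ and $y_2$, away from
the values of $h$ and $\hat h$ at the roots of $T$.  Now $T$ is coprime to the
other member of the pencil in $x_1$, and a generic $x_1$ gives simple roots. *)
Lemma split_quadric_separable (d : nat) (x1 y1 x2 y2 : F) : (0 < d)%N ->
  (split_quadric x1 y1 x2 y2)`_d != 0 ->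
  exists x1' y1' x2' y2',
    (split_quadric x1' y1' x2' y2')`_d != 0 /\
    separable_poly (split_quadric x1' y1' x2' y2').
Proof.
have common (A B : {poly F}) x rB : (A - x *: B)`_d != 0 -> rB != 0 ->
    exists2 y, (A - y *: B)`_d != 0 & rB.[y] != 0.
  move=> /coef_line_neq0[rA rA0 hA] rB0.
  have [n] := nat_nonroot (mulf_neq0 rA0 rB0).
  by rewrite hornerM mulf_eq0 negb_or => /andP[/hA]; exists n%:R.
move=> d0 c0.
have [y1' {}c0 gh0] : exists2 y,
    (split_quadric x1 y x2 y2)`_d != 0 & ('X - (gh`_0)%:P).[y] != 0.
  have e y : split_quadric x1 y x2 y2 =
      (g - x1%:P) * gh + (h - x2%:P) * (hh - y2%:P) - y *: (g - x1%:P).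
    by rewrite /split_quadric -mul_polyC; ring.
  move: c0; rewrite e => /common/(_ (negbT (polyXsubC_eq0 (gh`_0))))[y hy ?].
  by exists y => //; rewrite e.
pose T := gh - y1'%:P.
have T0 : T != 0.
  apply: contraNneq gh0 => /(congr1 (coefp 0)) /=.
  by rewrite coefB coefC coef0 !hornerE => /eqP; rewrite subr_eq0 eq_sym subr_eq0.
have [rh rh0 hP] := avoid_values h T0.
have [x2' {}c0 rhx] : exists2 x, (split_quadric x1 y1' x y2)`_d != 0 & rh.[x] != 0.
  have e y : split_quadric x1 y1' y y2 =
      (g - x1%:P) * T + h * (hh - y2%:P) - y *: (hh - y2%:P).
    by rewrite /split_quadric -mul_polyC /T; ring.
  move: c0; rewrite e => /common/(_ rh0)[y hy ?].
  by exists y => //; rewrite e.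
have [rhh rhh0 hhP] := avoid_values hh T0.
have [y2' {}c0 rhhy] :
    exists2 y, (split_quadric x1 y1' x2' y)`_d != 0 & rhh.[y] != 0.
  have e y : split_quadric x1 y1' x2' y =
      (g - x1%:P) * T + (h - x2'%:P) * hh - y *: (h - x2'%:P).
    by rewrite /split_quadric -mul_polyC /T; ring.
  move: c0; rewrite e => /common/(_ rhh0)[y hy ?].
  by exists y => //; rewrite e.
pose S := g * T + (h - x2'%:P) * (hh - y2'%:P).
have e x : split_quadric x y1' x2' y2' = S - x *: T.
  by rewrite /split_quadric -mul_polyC /S /T; ring.
have ST : coprimep S T.
  rewrite coprimep_sym; apply: Pdiv.ClosedField.root_coprimep => v Tv.
  rewrite /S hornerD !hornerM (rootP Tv) mulr0 add0r !hornerE mulf_neq0 //.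
    by rewrite subr_eq0 hP.
  by rewrite subr_eq0 hhP.
have nc : (1 < maxn (size S) (size T))%N.
  rewrite ltnNge geq_max; apply: contra c0 => /andP[sS sT].
  rewrite e coefB coefZ !nth_default ?mulr0 ?subr0 //; exact: leq_trans d0.
have [r r0 rP] := pencil_generic_separable ST nc.
move: c0; rewrite e => /common/(_ r0)[x cx rx].
by exists x, y1', x2', y2'; rewrite e; split => //; exact: rP.
Qed.

End SplitQuadric.

(** * Points where a multivariate polynomial does not vanish *)

Lemma meval_along_curve (F : comNzRingType) n (p : mpoly n F)
    (u : 'I_n -> {poly F}) :
  exists r : {poly F}, forall x, r.[x] = meval (fun i => (u i).[x]) p.
Proof.
exists (\sum_(m <- msupp p) (mcoeff m p)%:P * \prod_i u i ^+ m i) => x.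
rewrite horner_sum mevalE; apply: eq_bigr => m _.
rewrite hornerM hornerC horner_prod; congr (_ * _).
by apply: eq_bigr => i _; rewrite horner_exp.
Qed.

(** The coordinates are made natural numbers one after the other: in each of
them separately the polynomial is a nonzero univariate one.  This is how a
complex point of nonvanishing yields a real one. *)
Lemma meval_nat_point (F : numDomainType) n (p : mpoly n F) (t : 'I_n -> F) :
  meval t p != 0 -> exists s : 'I_n -> nat, meval (fun i => (s i)%:R) p != 0.
Proof.
move=> pt.
suff /(_ n) [s hs] : forall k, exists s : 'I_n -> nat,
    meval (fun i : 'I_n => if (i < k)%N then (s i)%:R else t i) p != 0.
  by exists s; move: hs; congr (_ != 0); apply: meval_eq => i; rewrite ltn_ord.
elim=> [|k [s hs]]; first by exists (fun=> 0%N).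
pose u (i : 'I_n) : {poly F} :=
  if i == k :> nat then 'X else (if (i < k)%N then (s i)%:R else t i)%:P.
have [r rE] := meval_along_curve p u.
have [|m rm] := @nat_nonroot _ r.
  have [kn|nk] := ltnP k n.
    apply: contraNneq hs => r0; rewrite -(horner0 (t (Ordinal kn))) -r0 rE.
    apply/eqP; apply: meval_eq => i; rewrite /u; case: eqP => [ik|_].
      by rewrite ik ltnn hornerX; congr t; apply: val_inj.
    by rewrite hornerC.
  apply: contraNneq hs => r0; rewrite -(horner0 0) -r0 rE.
  apply/eqP; apply: meval_eq => i; rewrite /u ltn_eqF ?hornerC //.
  exact: leq_trans (ltn_ord i) nk.
exists (fun i : 'I_n => if i == k :> nat then m else s i).
move: rm; rewrite rE; congr (_ != 0); apply: meval_eq => i; rewrite /u.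
case: eqP => [->|/eqP ik]; first by rewrite hornerX ltnSn.
by rewrite hornerC ltnS [(i <= k)%N]leq_eqVlt (negPf ik).
Qed.

(** Turns one complex equation in real unknowns into two real ones. *)
Lemma mpoly_Re_Im (R : rcfType) n (p : mpoly n R[i]%C) :
  exists pr pi : mpoly n R, forall s : 'I_n -> R,
    meval (fun i => (s i)%:C%C) p = (meval s pr +i* meval s pi)%C.
Proof.
exists (\sum_(m <- msupp p) complex.Re (mcoeff m p) *: mpolyX R m).
exists (\sum_(m <- msupp p) complex.Im (mcoeff m p) *: mpolyX R m) => s.
rewrite mevalE !raddf_sum /=.
elim/big_rec3: _ => [//|m y z w _ ->]; rewrite !mevalZ !mevalX.
have -> : \prod_i ((s i)%:C)%C ^+ m i = ((\prod_i s i ^+ m i)%:C)%C.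
  by rewrite rmorph_prod; apply: eq_bigr => i _; rewrite rmorphXn.
by case: (mcoeff m p) => a b /=; simpc.
Qed.

(** * Generic degree and separability *)

Lemma map_split_quadric (A B : comNzRingType) (f : {rmorphism A -> B})
    (u v w z : {poly A}) (a b c e : A) :
  map_poly f ((u - a%:P) * (v - b%:P) + (w - c%:P) * (z - e%:P)) =
  (map_poly f u - (f a)%:P) * (map_poly f v - (f b)%:P) +
  (map_poly f w - (f c)%:P) * (map_poly f z - (f e)%:P).
Proof. by rewrite rmorphD !rmorphM !rmorphB /= !map_polyC. Qed.

Section GenericQuadric.
Variables (F : numClosedFieldType) (ii : F) (g h gh hh : {poly F}).
Hypothesis ii0 : ii != 0.

(** Here $q_1 = t_0 + \imath t_1$, $\bar q_1 = t_0 - \imath t_1$ and likewise for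
$q_2$, but the $t_k$ are allowed to be complex. *)
Definition quadric_at (t : 'I_4 -> F) : {poly F} :=
  split_quadric g h gh hh
    (t (inord 0) + ii * t (inord 1)) (t (inord 0) - ii * t (inord 1))
    (t (inord 2) + ii * t (inord 3)) (t (inord 2) - ii * t (inord 3)).

Let cst (u : {poly F}) : {poly mpoly 4 F} := map_poly (@mpolyC 4 F) u.
Let X (k : nat) : mpoly 4 F := mpolyX F (mnm1 (inord k : 'I_4)).
Let generic_quadric : {poly mpoly 4 F} :=
  (cst g - (X 0 + ii *: X 1)%:P) * (cst gh - (X 0 - ii *: X 1)%:P) +
  (cst h - (X 2 + ii *: X 3)%:P) * (cst hh - (X 2 - ii *: X 3)%:P).

Let map_generic_quadric t : map_poly (meval t) generic_quadric = quadric_at t.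
Proof.
have mc u : map_poly (meval t) (cst u) = u.
  rewrite /cst -map_poly_comp map_poly_id // => c _ /=; exact: mevalC.
have mX k : meval t (X k) = t (inord k) by rewrite mevalXU.
rewrite /generic_quadric map_split_quadric /= !mc /quadric_at /split_quadric -!mX.
by rewrite !mevalD !mevalN !mevalZ.
Qed.

(** The polynomial $p$ is the product of the leading coefficient and of the
resultant of the generic quadric with its derivative.  Bounding the degree at
points with natural coordinates suffices, as these are Zariski dense. *)
Lemma generic_quadric_separable (d : nat) : (0 < d)%N ->
  (forall s : 'I_4 -> nat, (size (quadric_at (fun i => (s i)%:R)) <= d.+1)%N) ->
  (exists t, (quadric_at t)`_d != 0) ->
  exists2 p : mpoly 4 F, exists s : 'I_4 -> nat, meval (fun i => (s i)%:R) p != 0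
    & forall t, meval t p != 0 ->
      size (quadric_at t) = d.+1 /\ separable_poly (quadric_at t).
Proof.
move=> d0 le_size [t0 t0d].
have le_all t : (size (quadric_at t) <= d.+1)%N.
  apply/leq_sizeP => n dn; apply/eqP/negPn/negP.
  rewrite -map_generic_quadric coef_map => /meval_nat_point[s].
  rewrite -coef_map map_generic_quadric nth_default ?eqxx //.
  exact: leq_trans (le_size s) dn.
(* Dropping coefficients that vanish at every point gives size exactly d + 1. *)
pose D := take_poly d.+1 generic_quadric.
have mapD t : map_poly (meval t) D = quadric_at t.
  rewrite -map_generic_quadric; apply/polyP => n; rewrite !coef_map coef_take_poly.
  case: ltnP => // dn; rewrite -coef_map map_generic_quadric nth_default ?raddf0 //.
  exact: leq_trans (le_all t) dn.
have Dd t : meval t D`_d = (quadric_at t)`_d by rewrite -mapD coef_map.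
have sD : size D = d.+1.
  apply/eqP; rewrite eqn_leq size_take_poly /= ltnNge; apply/negP => sDd.
  by move: t0d; rewrite -Dd nth_default // raddf0 eqxx.
have lD : lead_coef D = D`_d by rewrite lead_coefE sD.
have sD' : size D^`() = d.
  apply/eqP; rewrite eqn_leq -ltnS -[X in (_ < X)%N]sD lt_size_deriv; last first.
    by rewrite -size_poly_gt0 sD.
  rewrite -{1}(prednK d0) ltnNge; apply/negP => /leq_sizeP/(_ _ (leqnn _)).
  rewrite coef_deriv (prednK d0) => /(congr1 (meval t0)) /eqP; apply/negP.
  by rewrite mevalMn meval0 Dd mulrn_eq0 negb_or -lt0n d0.
have lD' : lead_coef D^`() = D`_d *+ d.
  by rewrite lead_coefE sD' coef_deriv (prednK d0).
have res t : (quadric_at t)`_d != 0 ->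
    meval t (resultant D D^`()) = resultant (quadric_at t) (quadric_at t)^`().
  move=> cd; rewrite resultant_map -?deriv_map ?mapD //.
    by rewrite lD /= Dd.
  by rewrite lD' /= mevalMn Dd mulrn_eq0 negb_or -lt0n d0.
have sepE t : (quadric_at t)`_d != 0 ->
    (meval t (resultant D D^`()) != 0) = separable_poly (quadric_at t).
  move=> cd; rewrite res // resultant_eq0 unlock -leqNgt coprimep_def.
  rewrite eqn_leq size_poly_gt0 gcdp_eq0 negb_and andbC.
  suff -> : quadric_at t != 0 by [].
  by apply: contraNneq cd => ->; rewrite coef0.
exists (D`_d * resultant D D^`()).
  have [x1 [y1 [x2 [y2 [cd sep]]]]] := split_quadric_separable d0 t0d.
  pose t (i : 'I_4) := nth 0 [:: (x1 + y1) / 2; (x1 - y1) / (2 * ii);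
                            (x2 + y2) / 2; (x2 - y2) / (2 * ii)] i.
  have tE : quadric_at t = split_quadric g h gh hh x1 y1 x2 y2.
    rewrite /quadric_at /t !inordK //=.
    by congr split_quadric; field; rewrite ii0.
  apply: (@meval_nat_point _ _ _ t).
  rewrite mevalM mulf_neq0 //; first by rewrite Dd tE.
  by rewrite sepE tE.
move=> t; rewrite mevalM mulf_eq0 negb_or Dd => /andP[cd]; rewrite sepE //.
split=> //; apply/eqP; rewrite eqn_leq le_all ltnNge; apply: contra cd => ?.
by rewrite nth_default.
Qed.

End GenericQuadric.

Local Open Scope complex_scope.
Local Open Scope classical_set_scope.

(** * The norm form and the zeros of slice values *)

Section QuaternionNorm.
Variable K : comNzRingType.
Implicit Types x y z : quat K.

Definition qconj x : quat K :=
  mkq (qcoord x 0) (- qcoord x 1) (- qcoord x 2) (- qcoord x 3).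

(** Over the complex numbers this is the complexified norm form, a sum of squares
without absolute values. *)
Definition qnorm x : K :=
  qcoord x 0 ^+ 2 + qcoord x 1 ^+ 2 + qcoord x 2 ^+ 2 + qcoord x 3 ^+ 2.

Definition qdot x y : K :=
  qcoord x 0 * qcoord y 0 + qcoord x 1 * qcoord y 1 +
  qcoord x 2 * qcoord y 2 + qcoord x 3 * qcoord y 3.

Lemma qcoordM x y :
  [/\ qcoord (x * y) 0 = qcoord x 0 * qcoord y 0 - qcoord x 1 * qcoord y 1
        - qcoord x 2 * qcoord y 2 - qcoord x 3 * qcoord y 3,
      qcoord (x * y) 1 = qcoord x 0 * qcoord y 1 + qcoord x 1 * qcoord y 0
        + qcoord x 2 * qcoord y 3 - qcoord x 3 * qcoord y 2,
      qcoord (x * y) 2 = qcoord x 0 * qcoord y 2 - qcoord x 1 * qcoord y 3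
        + qcoord x 2 * qcoord y 0 + qcoord x 3 * qcoord y 1 &
      qcoord (x * y) 3 = qcoord x 0 * qcoord y 3 + qcoord x 1 * qcoord y 2
        - qcoord x 2 * qcoord y 1 + qcoord x 3 * qcoord y 0].
Proof. by split; rewrite qcoord_mkq. Qed.

Lemma qcoord1 :
  [/\ qcoord (1 : quat K) 0 = 1, qcoord (1 : quat K) 1 = 0,
      qcoord (1 : quat K) 2 = 0 & qcoord (1 : quat K) 3 = 0].
Proof. by split; rewrite qcoord_mkq. Qed.

Lemma qcoord0 n : qcoord (0 : quat K) n = 0.
Proof. by rewrite /qcoord mxE. Qed.

Lemma qcoordN x n : qcoord (- x) n = - qcoord x n.
Proof. by rewrite /qcoord mxE. Qed.

Lemma qcoord_sum (J : Type) (r : seq J) (F : J -> quat K) n :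
  qcoord (\sum_(j <- r) F j) n = \sum_(j <- r) qcoord (F j) n.
Proof. by rewrite /qcoord summxE. Qed.

Lemma qmulK x : x * qconj x = (qnorm x)%:A.
Proof.
have [e0 e1 e2 e3] := qcoordM x (qconj x); have [i0 i1 i2 i3] := qcoord1.
apply: quatP; rewrite !qcoordZ i0 i1 i2 i3 e0 e1 e2 e3 /qconj !qcoord_mkq /qnorm.
by split; ring.
Qed.

Lemma qconjK x : qconj x * x = (qnorm x)%:A.
Proof.
have [e0 e1 e2 e3] := qcoordM (qconj x) x; have [i0 i1 i2 i3] := qcoord1.
apply: quatP; rewrite !qcoordZ i0 i1 i2 i3 e0 e1 e2 e3 /qconj !qcoord_mkq /qnorm.
by split; ring.
Qed.

Lemma qnormM x y : qnorm (x * y) = qnorm x * qnorm y.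
Proof.
by have [e0 e1 e2 e3] := qcoordM x y; rewrite /qnorm e0 e1 e2 e3; ring.
Qed.

Lemma qnormN x : qnorm (- x) = qnorm x.
Proof. by rewrite /qnorm !qcoordN !sqrrN. Qed.

Lemma qnormZ a x : qnorm (a *: x) = a ^+ 2 * qnorm x.
Proof. by rewrite /qnorm !qcoordZ; ring. Qed.

Lemma qnorm_conj x : qnorm (qconj x) = qnorm x.
Proof. by rewrite /qnorm !qcoord_mkq !sqrrN. Qed.

End QuaternionNorm.

Section UnitSphere.
Variable R : realType.
Notation C := R[i].
Notation H := (quat R).
Notation HC := (quat R[i]).
Notation S := (@unit_sphere R).
Implicit Types (I x y u v q : H) (w : HC) (z : C).

Lemma qnorm_eq0 x : (qnorm x == 0) = (x == 0).
Proof.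
apply/eqP/eqP => [|->]; last by rewrite /qnorm !qcoord0 expr0n !addr0.
rewrite /qnorm => n0; apply: quatP; rewrite !qcoord0.
by split; apply/eqP; rewrite -sqrf_eq0; apply/eqP; nra.
Qed.

Lemma unit_sphereP I : S I <-> qcoord I 0 = 0 /\ qnorm I = 1.
Proof.
rewrite /unit_sphere /= expr2; have [e0 e1 e2 e3] := qcoordM I I.
have [i0 i1 i2 i3] := qcoord1 R; rewrite /qnorm; split.
  move=> II.
  move: e0 e1 e2 e3; rewrite II !qcoordN i0 i1 i2 i3 => e0 e1 e2 e3.
  have I0 : qcoord I 0 = 0.
    apply/eqP/negPn/negP => n0.
    have z k : qcoord I 0 * k *+ 2 = 0 -> k = 0.
      by move/eqP; rewrite mulrn_eq0 /= mulf_eq0 (negPf n0) => /eqP.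
    have h1 : qcoord I 1 = 0 by apply: z; rewrite mulr2n; lra.
    have h2 : qcoord I 2 = 0 by apply: z; rewrite mulr2n; lra.
    have h3 : qcoord I 3 = 0 by apply: z; rewrite mulr2n; lra.
    by rewrite h1 h2 h3 in e0; nra.
  by split=> //; rewrite I0 in e0 *; lra.
move=> [I0 n1]; apply: quatP; rewrite !qcoordN e0 e1 e2 e3 i0 i1 i2 i3 I0.
by rewrite I0 in n1; split; lra.
Qed.

Lemma unit_sphereN I : S I -> S (- I).
Proof. by rewrite /unit_sphere /= sqrrN. Qed.

(** Left multiplication by $I$ is isometric and maps $v$ to a vector orthogonal
to $v$. *)
Lemma unit_rotation_norm I u v : S I -> u + I * v = 0 ->
  qnorm u = qnorm v /\ qdot u v = 0.
Proof.
move=> /unit_sphereP[I0 n1] /eqP; rewrite addr_eq0 => /eqP ->.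
rewrite qnormN qnormM n1 mul1r; split=> //.
have [e0 e1 e2 e3] := qcoordM I v.
by rewrite /qdot !qcoordN e0 e1 e2 e3 I0; ring.
Qed.

(** The solution is $I = - u v^{-1}$: orthogonality makes it purely imaginary and
equality of norms makes it a unit. *)
Lemma unit_rotation_exists u v : qnorm u = qnorm v -> qdot u v = 0 ->
  v != 0 -> exists2 I, S I & u + I * v = 0.
Proof.
move=> uv duv; rewrite -qnorm_eq0 => v0.
exists (- ((qnorm v)^-1 *: (u * qconj v))).
  apply/unit_sphereP; split.
    have [e0 _ _ _] := qcoordM u (qconj v).
    rewrite qcoordN qcoordZ e0 /qconj !qcoord_mkq; apply/eqP.
    rewrite oppr_eq0 mulf_eq0 -duv; apply/orP; right; apply/eqP.
    by rewrite /qdot; ring.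
  by rewrite qnormN qnormZ qnormM qnorm_conj uv; field.
by rewrite mulNr -scalerAl -mulrA qconjK -scalerAr mulr1 scalerA mulVf // scale1r subrr.
Qed.

Lemma unit_rotation_unique I J u v : v != 0 ->
  u + I * v = 0 -> u + J * v = 0 -> I = J.
Proof.
rewrite -qnorm_eq0 => v0 Iv Jv; apply/eqP; rewrite -subr_eq0.
have : (I - J) * v = 0.
  by rewrite mulrBl; apply/eqP; rewrite subr_eq0; apply/eqP/(addrI u); rewrite Iv.
move/(congr1 (fun y => y * qconj v)); rewrite -mulrA qmulK mul0r -scalerAr mulr1.
by move/eqP; rewrite scaler_eq0 (negPf v0).
Qed.

Lemma qcoord_slice_value I w n :
  qcoord (slice_value I w) n = qcoord (HRe w) n + qcoord (I * HIm w) n.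
Proof. by rewrite /slice_value qcoordD. Qed.

Lemma qcoord_HRe w n : qcoord (HRe w) n = complex.Re (qcoord w n).
Proof. by rewrite /qcoord mxE. Qed.

Lemma qcoord_HIm w n : qcoord (HIm w) n = complex.Im (qcoord w n).
Proof. by rewrite /qcoord mxE. Qed.

Lemma qnorm_complex w :
  qnorm w = (qnorm (HRe w) - qnorm (HIm w)) +i* (qdot (HRe w) (HIm w) *+ 2).
Proof.
rewrite /qnorm /qdot !qcoord_HRe !qcoord_HIm.
case: (qcoord w 0) (qcoord w 1) (qcoord w 2) (qcoord w 3).
move=> a0 b0 [a1 b1] [a2 b2] [a3 b3] /=; simpc.
by congr (_ +i* _); ring.
Qed.

(** The real and imaginary parts of $N(u + \imath v)$ are $|u|^2 - |v|^2$ and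
$2 \langle u, v \rangle$, the two obstructions to $u + I v = 0$. *)
Lemma slice_value_eq0_qnorm I w : S I -> slice_value I w = 0 -> qnorm w = 0.
Proof.
move=> SI /(unit_rotation_norm SI)[e1 e2].
by rewrite qnorm_complex e1 e2 subrr mul0rn.
Qed.

Lemma HIm_neq0 w : qnorm w = 0 -> w != 0 -> HIm w != 0.
Proof.
rewrite qnorm_complex => -[e1 _]; apply: contraNneq => v0.
have n0 : qnorm (0 : H) = 0 by apply/eqP; rewrite qnorm_eq0.
have u0 : HRe w = 0.
  by apply/eqP; rewrite -qnorm_eq0; move: e1; rewrite v0 n0 subr0 => ->.
apply/eqP/rowP => k; rewrite mxE.
have := congr1 (fun y : H => y 0 k) u0; have := congr1 (fun y : H => y 0 k) v0.
by rewrite !mxE; case: (w 0 k) => a b /= -> ->.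
Qed.

Lemma slice_zero_exists w : qnorm w = 0 -> w != 0 ->
  exists2 I, S I & slice_value I w = 0.
Proof.
move=> n0 w0; have v0 := HIm_neq0 n0 w0.
move: n0; rewrite qnorm_complex => -[/eqP]; rewrite subr_eq0 => /eqP e1 /eqP.
by rewrite mulrn_eq0 /= => /eqP e2; exact: unit_rotation_exists.
Qed.

Lemma slice_zero_unique I J w : w != 0 -> S I ->
  slice_value I w = 0 -> slice_value J w = 0 -> I = J.
Proof.
move=> w0 SI eI; have n0 := slice_value_eq0_qnorm SI eI.
by move: eI; apply: unit_rotation_unique; exact: HIm_neq0.
Qed.

Lemma qcoord_to_slice I z : qcoord I 0 = 0 ->
  qcoord (to_slice I z) 0 = complex.Re z /\
  qnorm (to_slice I z) = complex.Re z ^+ 2 + complex.Im z ^+ 2 * qnorm I.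
Proof.
move=> I0; have [i0 i1 i2 i3] := qcoord1 R.
rewrite /qnorm /to_slice !qcoordD !qcoordZ i0 i1 i2 i3 I0.
by split; ring.
Qed.

Lemma to_slice_inj_upper I J z z' : S I -> S J ->
  0 < complex.Im z -> 0 < complex.Im z' -> to_slice I z = to_slice J z' -> z = z'.
Proof.
move=> /unit_sphereP[I0 nI] /unit_sphereP[J0 nJ] z0 z0' e.
have [a1 b1] := qcoord_to_slice z I0; have [a2 b2] := qcoord_to_slice z' J0.
move: a2 b2; rewrite -e a1 b1 nI nJ => a2 b2.
case: z z' a2 b2 z0 z0' {a1 b1 e} => x y [x' y'] /= <- b2 y0 y0'; congr (_ +i* _).
by apply/eqP; rewrite -(eqrXn2 (n := 2)) ?ltW //; apply/eqP; lra.
Qed.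

Lemma to_sliceJ I z : to_slice I z = to_slice (- I) z^*.
Proof. by case: z => x y; rewrite /to_slice /= scaleNr scalerN opprK. Qed.

Lemma to_slice_nonreal I z : S I -> complex.Im z != 0 -> ~ real_axis (to_slice I z).
Proof.
move=> /unit_sphereP[I0 nI] z0 [a _ e].
have [a1 b1] := qcoord_to_slice z I0; have [i0 i1 i2 i3] := qcoord1 R.
move: a1 b1; rewrite -e /qnorm !qcoordZ i0 i1 i2 i3 -/(qnorm I) nI mulr1 => <-.
move=> b1; have : complex.Im z ^+ 2 = 0 by nra.
by move/eqP; rewrite sqrf_eq0 (negPf z0).
Qed.

Lemma nonreal_to_slice x : ~ real_axis x ->
  exists I z, [/\ S I, 0 < complex.Im z & x = to_slice I z].
Proof.
have [i0 i1 i2 i3] := qcoord1 R.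
move=> xnr; pose s := qcoord x 1 ^+ 2 + qcoord x 2 ^+ 2 + qcoord x 3 ^+ 2.
have s0 : 0 < s.
  rewrite lt_def; apply/andP; split; last by rewrite !addr_ge0 ?sqr_ge0.
  apply/eqP => e; apply: xnr; exists (qcoord x 0) => //.
  apply: quatP; rewrite !qcoordZ i0 i1 i2 i3 mulr0 mulr1.
  by rewrite /s in e; split=> //; apply/esym/eqP; rewrite -sqrf_eq0; apply/eqP; nra.
have r0 : 0 < Num.sqrt s by rewrite sqrtr_gt0.
have rr : Num.sqrt s ^+ 2 = s by rewrite sqr_sqrtr // ltW.
exists ((Num.sqrt s)^-1 *: mkq 0 (qcoord x 1) (qcoord x 2) (qcoord x 3)).
exists (qcoord x 0 +i* Num.sqrt s); split=> //.
  apply/unit_sphereP; split; first by rewrite qcoordZ qcoord_mkq mulr0.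
  rewrite qnormZ exprVn rr /qnorm !qcoord_mkq expr0n add0r -/s.
  by rewrite mulVf // gt_eqF.
rewrite /to_slice /= scalerA divff ?gt_eqF // scale1r.
apply: quatP; rewrite !qcoordD !qcoordZ i0 i1 i2 i3 !qcoord_mkq.
by rewrite mulr0 mulr1 !add0r addr0.
Qed.

End UnitSphere.

(** * The common stem function of a slice-polynomial function and its companion *)

Section CompanionStem.
Variable R : realType.
Notation C := R[i].
Notation H := (quat R).
Notation HC := (quat R[i]).
Notation S := (@unit_sphere R).
Implicit Types (I x y u v q : H) (w : HC) (z : C) (a b : {poly H}).

Definition idem_plus : HC := (2^-1)%:C *: (1 - 'i *: qi).
Definition idem_minus : HC := (2^-1)%:C *: (1 + 'i *: qi).

Definition upper_stem a b z : HC :=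
  poly_stem a z * idem_plus + poly_stem b z * idem_minus.

(** Above the real axis $l_+$ and $l_-$ have the constant stems [idem_plus] and
[idem_minus]. *)
Lemma decomposition_upper a b (P : H -> H) I z :
    slice_decomposition a b P -> S I -> 0 < complex.Im z ->
  P (to_slice I z) = slice_value I (upper_stem a b z).
Proof.
move=> dP SI z0; have zn : nonreal z by rewrite /nonreal /= gt_eqF.
rewrite (dP I z SI zn) /ellp_stem /ellm_stem z0; reflexivity.
Qed.

(** Below the real axis the stems of $l_+$ and $l_-$ are exchanged, which undoes
the exchange of $a$ and $b$ in the companion. *)
Lemma decomposition_lower a b (P : H -> H) I z :
    slice_decomposition b a P -> S I -> complex.Im z < 0 ->
  P (to_slice I z) = slice_value I (upper_stem a b z).
Proof.
move=> dP SI z0; have zn : nonreal z by rewrite /nonreal /= lt_eqF.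
have z0' : (0 < complex.Im z) = false by rewrite ltNge ltW.
rewrite (dP I z SI zn) /ellp_stem /ellm_stem z0' addrC; reflexivity.
Qed.

Lemma upper_stem_poly a b : exists w : nat -> {poly C},
  forall z k, qcoord (upper_stem a b z) k = (w k).[z].
Proof.
have stem_poly (c : {poly H}) (e : HC) : exists w : nat -> {poly C},
    forall z k, qcoord (poly_stem c z * e) k = (w k).[z].
  exists (fun k => \poly_(n < size c) qcoord (complexify c`_n * e) k) => z k.
  rewrite /poly_stem mulr_suml qcoord_sum horner_poly.
  by apply: eq_bigr => n _; rewrite -scalerAl qcoordZ mulrC.
have [wa waE] := stem_poly a idem_plus.
have [wb wbE] := stem_poly b idem_minus.
exists (fun k => wa k + wb k) => z k.
rewrite hornerD -waE -wbE; exact: qcoordD.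
Qed.

(** The twistor polynomials mention both the conjugation of closed fields and
the one of [R[i]]. *)
Lemma num_conjE z : Num.conj z = conjc z.
Proof. by []. Qed.

(** The points $n + \imath$ are infinitely many. *)
Lemma poly_eq_upper (p r : {poly C}) :
  (forall z, 0 < complex.Im z -> p.[z] = r.[z]) -> p = r.
Proof.
move=> pr; apply/eqP; rewrite -subr_eq0; apply/negPn/negP => d0.
have [|n] := @nat_nonroot _ ((p - r) \Po ('X + 'i%:P)).
  by rewrite comp_poly2_eq0 // size_XaddC.
rewrite horner_comp !hornerE pr ?subrr ?eqxx //.
suff -> : n%:R + 'i = n%:R +i* 1 :> C by rewrite ltr01.
by rewrite -[n%:R]/(n%:R : C) -(rmorph_nat (real_complex R)) /=; simpc.
Qed.

(** On $C_i$ the unit $i$ acts like $\imath$ or like $- \imath$, according to the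
half plane; so $(g, h)$ and $(\hat g, \hat h)$ are the two isotropic coordinate
pairs $w_0 \pm \imath w_1$, $w_2 \pm \imath w_3$ of the common stem. *)
Lemma twistor_polys_upper_stem a b (P : H -> H) (g h gh hh : {poly C}) :
    slice_decomposition a b P -> twistor_polys P g h gh hh ->
  forall z, let w := upper_stem a b z in
    [/\ g.[z] = qcoord w 0 + 'i * qcoord w 1,
        gh.[z] = qcoord w 0 - 'i * qcoord w 1,
        h.[z] = qcoord w 2 + 'i * qcoord w 3 &
        hh.[z] = qcoord w 2 - 'i * qcoord w 3].
Proof.
move=> dP [upP loP]; have [w wE] := upper_stem_poly a b.
have Si : S qi.
  by apply/unit_sphereP; rewrite /qnorm !qcoord_mkq expr0n expr1n add0r !addr0.
pose rot (s t : {poly C}) := s + 'i%:P * t.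
have coords (s t : C) : let x := to_slice qi s + to_slice qi t * qj in
    [/\ qcoord x 0 = complex.Re s, qcoord x 1 = complex.Im s,
        qcoord x 2 = complex.Re t & qcoord x 3 = complex.Im t].
  have [i0 i1 i2 i3] := qcoord1 R; rewrite /=.
  have [e0 e1 e2 e3] := qcoordM (to_slice qi t) qj.
  rewrite !qcoordD e0 e1 e2 e3 /to_slice !qcoordD !qcoordZ i0 i1 i2 i3.
  by rewrite !qcoord_mkq; split; ring.
have valc (v : HC) :
  [/\ qcoord (slice_value qi v) 0 = complex.Re (qcoord v 0) - complex.Im (qcoord v 1),
      qcoord (slice_value qi v) 1 = complex.Re (qcoord v 1) + complex.Im (qcoord v 0),
      qcoord (slice_value qi v) 2 = complex.Re (qcoord v 2) - complex.Im (qcoord v 3) &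
      qcoord (slice_value qi v) 3 = complex.Re (qcoord v 3) + complex.Im (qcoord v 2)].
  have [e0 e1 e2 e3] := qcoordM qi (HIm v).
  rewrite !qcoord_slice_value e0 e1 e2 e3 !qcoord_HRe !qcoord_HIm !qcoord_mkq.
  by split; ring.
have valcN (v : HC) :
  [/\ qcoord (slice_value (- qi) v) 0 = complex.Re (qcoord v 0) + complex.Im (qcoord v 1),
      qcoord (slice_value (- qi) v) 1 = complex.Re (qcoord v 1) - complex.Im (qcoord v 0),
      qcoord (slice_value (- qi) v) 2 = complex.Re (qcoord v 2) + complex.Im (qcoord v 3) &
      qcoord (slice_value (- qi) v) 3 = complex.Re (qcoord v 3) - complex.Im (qcoord v 2)].
  have [e0 e1 e2 e3] := qcoordM qi (HIm v).
  rewrite !qcoord_slice_value mulNr !qcoordN e0 e1 e2 e3 !qcoord_HRe !qcoord_HIm.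
  by rewrite !qcoord_mkq; split; ring.
have eqC (s t : C) : complex.Re s = complex.Re t -> complex.Im s = complex.Im t -> s = t.
  by case: s t => ? ? [? ?] /= -> ->.
have ReI (s t : C) : complex.Re (s + 'i * t) = complex.Re s - complex.Im t.
  by case: s t => ? ? [? ?] /=; ring.
have ImI (s t : C) : complex.Im (s + 'i * t) = complex.Re t + complex.Im s.
  by case: s t => ? ? [? ?] /=; ring.
have up z : 0 < complex.Im z -> g.[z] = (rot (w 0%N) (w 1%N)).[z] /\
    h.[z] = (rot (w 2%N) (w 3%N)).[z].
  move=> z0; have := upP z z0; rewrite (decomposition_upper dP Si z0) => e.
  have [c0 c1 c2 c3] := coords g.[z] h.[z].
  have [v0 v1 v2 v3] := valc (upper_stem a b z).
  rewrite /rot !hornerE -!wE; split; apply: eqC; rewrite ?ReI ?ImI.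
  - by rewrite -v0 e.
  - by rewrite -v1 e.
  - by rewrite -v2 e.
  - by rewrite -v3 e.
have lo z : 0 < complex.Im z -> gh.[z] = (rot (w 0%N) (- w 1%N)).[z] /\
    hh.[z] = (rot (w 2%N) (- w 3%N)).[z].
  move=> z0; have := loP z^*; rewrite !num_conjE conjcK.
  have -> : complex.Im z^* < 0 by case: z z0 => x y /=; rewrite oppr_lt0.
  move=> /(_ isT); rewrite to_sliceJ conjcK.
  rewrite (decomposition_upper dP (unit_sphereN Si) z0) => e.
  have [c0 c1 c2 c3] := coords gh.[z]^* hh.[z]^*.
  have [v0 v1 v2 v3] := valcN (upper_stem a b z).
  have ImN (s : C) : complex.Im s^* = - complex.Im s by case: s.
  have ReJ (s : C) : complex.Re s^* = complex.Re s by case: s.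
  rewrite -e v0 ReJ in c0; rewrite -e v1 ImN in c1.
  rewrite -e v2 ReJ in c2; rewrite -e v3 ImN in c3.
  rewrite /rot !hornerE -!wE; split; apply: eqC; rewrite ?ReI ?ImI ?raddfN /=.
  - by rewrite -c0; case: (qcoord _ 1) => ? ? /=; ring.
  - by apply: oppr_inj; rewrite -c1; case: (qcoord _ 1) => ? ? /=; ring.
  - by rewrite -c2; case: (qcoord _ 3) => ? ? /=; ring.
  - by apply: oppr_inj; rewrite -c3; case: (qcoord _ 3) => ? ? /=; ring.
have -> : g = rot (w 0%N) (w 1%N) by apply: poly_eq_upper => z /up[].
have -> : h = rot (w 2%N) (w 3%N) by apply: poly_eq_upper => z /up[].
have -> : gh = rot (w 0%N) (- w 1%N) by apply: poly_eq_upper => z /lo[].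
have -> : hh = rot (w 2%N) (- w 3%N) by apply: poly_eq_upper => z /lo[].
by move=> z; rewrite /rot !hornerE -!wE !mulrN.
Qed.

End CompanionStem.

(** * The extension to the real axis *)

Section RealExtension.
Variable R : realType.
Notation C := R[i].
Notation H := (quat R).
Notation HC := (quat R[i]).
Notation S := (@unit_sphere R).
Implicit Types (I x y u v q : H) (w : HC) (z : C) (a b : {poly H}).

Lemma horner_vertical_line (p : {poly C}) (alpha : R) :
  exists pr pi : {poly R},
    forall beta, p.[alpha +i* beta] = pr.[beta] +i* pi.[beta].
Proof.
elim/poly_ind: p => [|p [s t] [pr [pi e]]].
  by exists 0, 0 => beta; rewrite !horner0.
exists (alpha *: pr - pi * 'X + s%:P), (pr * 'X + alpha *: pi + t%:P) => beta.
rewrite !hornerE e; simpc; congr (_ +i* _); ring.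
Qed.

(** On a vertical line the slice value is a combination of fixed quaternions whose
coefficients are real polynomials in the height. *)
Lemma upper_stem_vertical_cvg a b I (alpha : R) :
  slice_value I (upper_stem a b (alpha +i* beta)) @[beta --> 0^'+] -->
  slice_value I (upper_stem a b alpha%:C).
Proof.
have [w wE] := upper_stem_poly a b.
have [pr /choice[pi wri]] := choice (fun k => horner_vertical_line (w k) alpha).
pose u beta : H := mkq (pr 0%N).[beta] (pr 1%N).[beta] (pr 2%N).[beta] (pr 3%N).[beta].
pose v beta : H := mkq (pi 0%N).[beta] (pi 1%N).[beta] (pi 2%N).[beta] (pi 3%N).[beta].
have mkqE (c0 c1 c2 c3 : R) : mkq c0 c1 c2 c3 =
    c0 *: 1 + c1 *: qi + c2 *: qj + c3 *: qk :> H.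
  have [i0 i1 i2 i3] := qcoord1 R.
  apply: quatP; rewrite !qcoordD !qcoordZ i0 i1 i2 i3 !qcoord_mkq.
  by split; ring.
have stemE beta : slice_value I (upper_stem a b (alpha +i* beta)) =
    u beta + I * v beta.
  rewrite /slice_value; congr (_ + I * _); apply: quatP;
    by rewrite ?qcoord_HRe ?qcoord_HIm !wE !wri !qcoord_mkq.
have term (r : {poly R}) (c : H) : r.[beta] *: c @[beta --> (0 : R)] --> r.[0] *: c.
  by apply: cvgZr_tmp; exact: continuous_horner.
rewrite -[alpha%:C]/(alpha +i* 0); under eq_fun do rewrite stemE.
rewrite stemE; apply: cvg_at_right_filter.
rewrite /u /v; under eq_fun do rewrite !mkqE !mulrDr -!scalerAr.
rewrite !mkqE !mulrDr -!scalerAr.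
exact: (cvgD (cvgD (cvgD (cvgD (term _ _) (term _ _)) (term _ _)) (term _ _))
             (cvgD (cvgD (cvgD (term _ _) (term _ _)) (term _ _)) (term _ _))).
Qed.

Lemma real_extensionE a b (P : H -> H) I (alpha : R) :
    slice_decomposition a b P -> S I ->
  real_extension P I alpha = slice_value I (upper_stem a b alpha%:C).
Proof.
move=> dP SI; apply: (@cvg_lim _ (@norm_hausdorff _ _)).
have e : \forall beta \near 0^'+,
    slice_value I (upper_stem a b (alpha +i* beta)) = P (alpha%:A + beta *: I).
  near=> beta; have b0 : 0 < beta by near: beta; exact: nbhs_right_gt.
  exact/esym/(decomposition_upper (z := alpha +i* beta) dP SI).
apply: cvg_trans (@upper_stem_vertical_cvg a b I alpha).
exact: (near_eq_cvg e).
Unshelve. all: by end_near. Qed.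

End RealExtension.

(** * Roots of the twistor polynomial and points of the fibres *)

Lemma card_eq_seq_image (T : pointedType) (E : choiceType) (e0 : E) (s : seq E)
    (A : set T) (f : E -> T) :
    uniq s -> {in s &, injective f} ->
    (forall x, A x <-> exists2 e, e \in s & f e = x) ->
  (A #= `I_(size s))%card.
Proof.
move=> us injf Af; apply/card_esym/card_set_bijP.
exists (fun n => f (nth e0 s n)); split.
- by move=> n /= ns; apply/Af; exists (nth e0 s n) => //; exact: mem_nth.
- move=> m n; rewrite !inE /= => ms ns /injf; rewrite !mem_nth // => /(_ isT isT).
  by move/eqP; rewrite nth_uniq // => /eqP.
- move=> x /Af[e es <-]; exists (index e s); rewrite /= ?index_mem //.
  by rewrite nth_index.
Qed.

Section TwistorDegree.
Variable R : realType.
Notation C := R[i].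
Notation H := (quat R).
Notation HC := (quat R[i]).
Notation S := (@unit_sphere R).
Implicit Types (I x y u v q : H) (w : HC) (z : C) (a b : {poly H}).

Lemma twistor_polyE (g h gh hh : {poly C}) q :
  twistor_poly g h gh hh q =
  quadric_at 'i g h gh hh (fun k => (q 0 k)%:C).
Proof.
have qE (s t : R) : s +i* t = s%:C + 'i * t%:C by simpc.
have qJ (s t : R) : (s +i* t)^* = s%:C - 'i * t%:C by simpc.
rewrite /twistor_poly /quadric_at /split_quadric !num_conjE /qfst /qsnd !qJ !qE.
by rewrite /qcoord; ring.
Qed.

(** For $n > 0$ the coefficient of degree $n$ is affine in $q$; testing at
$q = 0, 1, i, j, k$ isolates the coefficients of $g, h, \hat g, \hat h$. *)
Lemma twistor_polys_const (g h gh hh : {poly C}) :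
    (forall q, (size (twistor_poly g h gh hh q) <= 1)%N) ->
  [/\ size g <= 1, size h <= 1, size gh <= 1 & size hh <= 1]%N.
Proof.
move=> small.
have coef0 q n : (0 < n)%N -> (g * gh + h * hh)`_n =
    g`_n * (qfst q)^* + gh`_n * qfst q + h`_n * (qsnd q)^* + hh`_n * qsnd q.
  move=> n0; apply/eqP; rewrite -subr_eq0.
  have := coef_split_quadric g h gh hh (qfst q) (qfst q)^* (qsnd q) (qsnd q)^* n0.
  move=> <-; have <- : twistor_poly g h gh hh q = split_quadric g h gh hh
      (qfst q) (qfst q)^* (qsnd q) (qsnd q)^*.
    by rewrite /twistor_poly /split_quadric !num_conjE; ring.
  by rewrite nth_default //; exact: leq_trans (small q) n0.
have coefs n : (0 < n)%N -> [/\ g`_n = 0, h`_n = 0, gh`_n = 0 & hh`_n = 0].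
  move=> n0; move: (coef0 0 n n0) (coef0 1 n n0) (coef0 qi n n0)
    (coef0 qj n n0) (coef0 qk n n0).
  have [i0 i1 i2 i3] := qcoord1 R.
  rewrite /qfst /qsnd !qcoord0 i0 i1 i2 i3 !qcoord_mkq.
  move: (_`_n) (g`_n) (h`_n) (gh`_n) (hh`_n) => c s t s' t'.
  case: c s t s' t' => c c' [s1 s2] [t1 t2] [s1' s2'] [t1' t2'].
  simpc => -[-> ->] [e1 e2] [e3 e4] [e5 e6] [e7 e8].
  by split; congr (_ +i* _); lra.
by split; apply/leq_sizeP => n /coefs[].
Qed.

Lemma slice_value_conj I w : slice_value I (HCconj w) = slice_value (- I) w.
Proof.
rewrite /slice_value mulNr -mulrN; congr (_ + I * _).
  by apply/rowP => k; rewrite !mxE; case: (w 0 k).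
by apply/rowP => k; rewrite !mxE; case: (w 0 k).
Qed.

Lemma Im_sign_near z : nonreal z -> \forall w \near (z : C^o),
  (0 < complex.Im w) = (0 < complex.Im z).
Proof.
rewrite /nonreal /= => z0.
have e0 : 0 < (`|complex.Im z|%:C : C) by rewrite ltcR normr_gt0.
apply/nbhs_ballP; exists `|complex.Im z|%:C => //= w.
rewrite -ball_normE /= normc_def ltcR => lt_norm.
have : `|complex.Im z - complex.Im w| < `|complex.Im z|.
  apply: le_lt_trans lt_norm; rewrite -sqrtr_sqr ler_sqrt.
    by case: z w {z0 e0} => ? ? [? ?] /=; rewrite lerDr sqr_ge0.
  by rewrite addr_ge0 ?sqr_ge0.
rewrite ltr_norml => /andP[l1 l2]; move: z0 l1 l2 {e0 lt_norm}.
move: (complex.Im z) (complex.Im w) => s t.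
case: (ltrgt0P s) => // zs _ l1 l2; first by apply/idP; lra.
by apply/negbTE; rewrite -leNgt; lra.
Qed.

(** The stem function equals $w$ above the real axis and $\bar w$ below it, so it
is only locally constant. *)
Lemma upper_stem_const_slice_constant a b (P : H -> H) w :
    slice_decomposition a b P -> (forall z, upper_stem a b z = w) ->
  slice_constant (@nonreal R) P.
Proof.
move=> dP wE.
have HK : HCconj (HCconj w) = w by apply/rowP => k; rewrite !mxE conjcK.
exists (fun z => if 0 < complex.Im z then w else HCconj w); split.
- move=> z; rewrite /nonreal /= => z0.
  have -> : (0 < complex.Im z^*) = ~~ (0 < complex.Im z).
    by case: z z0 => s t /=; rewrite oppr_gt0; case: ltrgt0P.
  by case: (0 < complex.Im z); rewrite /= ?HK.
- move=> z /Im_sign_near; apply: filterS => y /= ->; reflexivity.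
move=> I z SI; rewrite /nonreal /= => z0; case: ltP => [zp|zn].
  by rewrite (decomposition_upper dP SI zp) wE.
rewrite to_sliceJ (decomposition_upper dP (unit_sphereN SI)) ?wE ?slice_value_conj //.
by move: z0 zn; case: z => s t /=; case: ltrgt0P; lra.
Qed.

Lemma twistor_degree_gt0 a b (P : H -> H) (g h gh hh : {poly C}) :
    slice_decomposition a b P -> twistor_polys P g h gh hh ->
    ~ slice_constant (@nonreal R) P ->
  exists q, (1 < size (twistor_poly g h gh hh q))%N.
Proof.
move=> dP tP; apply: contra_notP => /forallNP small.
have [|sg sh sgh shh] := @twistor_polys_const g h gh hh.
  by move=> q; rewrite leqNgt; apply/negP/small.
have hconst (p : {poly C}) : (size p <= 1)%N -> forall z, p.[z] = p`_0.
  by move=> sp z; rewrite {1}(size1_polyC sp) hornerC.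
have wE z : upper_stem a b z = upper_stem a b 0.
  have [e1 e2 e3 e4] := twistor_polys_upper_stem dP tP z.
  have [f1 f2 f3 f4] := twistor_polys_upper_stem dP tP 0.
  rewrite (hconst _ sg) in e1; rewrite (hconst _ sg) in f1.
  rewrite (hconst _ sgh) in e2; rewrite (hconst _ sgh) in f2.
  rewrite (hconst _ sh) in e3; rewrite (hconst _ sh) in f3.
  rewrite (hconst _ shh) in e4; rewrite (hconst _ shh) in f4.
  have two : forall s t s' t' c c' : C, c = s + 'i * t -> c' = s - 'i * t ->
      c = s' + 'i * t' -> c' = s' - 'i * t' -> s = s' /\ t = t'.
    move=> [s1 s2] [t1 t2] [s1' s2'] [t1' t2'] [c1 c2] [c1' c2']; simpc.
    by move=> [? ?] [? ?] [? ?] [? ?]; split; congr (_ +i* _); lra.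
  have [w0 w1] := two _ _ _ _ _ _ e1 e2 f1 f2.
  have [w2 w3] := two _ _ _ _ _ _ e3 e4 f3 f4.
  by apply: quatP; split.
exact: (upper_stem_const_slice_constant dP wE).
Qed.

(** $(w_0 + \imath w_1)(w_0 - \imath w_1) + (w_2 + \imath w_3)(w_2 - \imath w_3)
= \sum_k w_k^2$ applied to $w = W(z) - q$. *)
Lemma horner_twistor_poly a b (P : H -> H) (g h gh hh : {poly C}) q z :
    slice_decomposition a b P -> twistor_polys P g h gh hh ->
  (twistor_poly g h gh hh q).[z] = qnorm (upper_stem a b z - complexify q).
Proof.
move=> dP tP; have [e1 e2 e3 e4] := twistor_polys_upper_stem dP tP z.
rewrite twistor_polyE horner_split_quadric e1 e2 e3 e4.
have qC k : qcoord (complexify q) k = (q 0 (inord k))%:C.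
  by rewrite /qcoord mxE.
rewrite /qnorm !qcoordD !qcoordN !qC.
have ii : 'i * 'i = -1 :> C by simpc.
have sq (s t x y : C) : (s + 'i * t - (x + 'i * y)) * (s - 'i * t - (x - 'i * y)) =
    (s - x) ^+ 2 + (t - y) ^+ 2.
  transitivity ((s - x) ^+ 2 - 'i * 'i * (t - y) ^+ 2); first by ring.
  by rewrite ii mulN1r opprK.
by rewrite !sq addrA.
Qed.

(** If $W(z) = q$ then all four factors of $D_q$ vanish at $z$, a double root. *)
Lemma upper_stem_neq_at_root a b (P : H -> H) (g h gh hh : {poly C}) q z :
    slice_decomposition a b P -> twistor_polys P g h gh hh ->
    separable_poly (twistor_poly g h gh hh q) ->
    root (twistor_poly g h gh hh q) z ->
  upper_stem a b z - complexify q != 0.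
Proof.
move=> dP tP; rewrite unlock => /coprimep_root sep /sep; apply: contraNneq.
have [e1 e2 e3 e4] := twistor_polys_upper_stem dP tP z.
move=> /eqP; rewrite subr_eq0 => /eqP wq; rewrite {}wq in e1 e2 e3 e4.
have qC k : qcoord (complexify q) k = (q 0 (inord k))%:C.
  by rewrite /qcoord mxE.
rewrite !qC in e1 e2 e3 e4.
by rewrite twistor_polyE /quadric_at -e1 -e2 -e3 -e4 deriv_split_quadric_eq0.
Qed.

(** Over each root $z$ there is exactly one $I$, here $\phi(z)$, and over the other
points none. *)
Lemma root_point a b (P : H -> H) (g h gh hh : {poly C}) q :
    slice_decomposition a b P -> twistor_polys P g h gh hh ->
    separable_poly (twistor_poly g h gh hh q) ->
  exists phi : C -> H,
    (forall z, root (twistor_poly g h gh hh q) z ->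
      S (phi z) /\ slice_value (phi z) (upper_stem a b z) = q) /\
    (forall z I, S I -> slice_value I (upper_stem a b z) = q ->
      root (twistor_poly g h gh hh q) z /\ I = phi z).
Proof.
move=> dP tP sep; set D := twistor_poly g h gh hh q.
have valE I z : slice_value I (upper_stem a b z - complexify q) = 0 <->
    slice_value I (upper_stem a b z) = q.
  have e := slice_valueD I (upper_stem a b z - complexify q) (complexify q).
  rewrite subrK slice_value_complexify in e.
  by split=> [e0|eq]; [rewrite e e0 add0r | apply: (addIr q); rewrite -e eq add0r].
have normD z : root D z <-> qnorm (upper_stem a b z - complexify q) = 0.
  by rewrite -(horner_twistor_poly q z dP tP); split=> /rootP.
have wn z := upper_stem_neq_at_root dP tP sep (z := z).
have ex z : exists I, root D z -> S I /\ slice_value I (upper_stem a b z) = q.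
  have [rz|nrz] := boolP (root D z); last by exists 0.
  have [I SI /valE eI] := slice_zero_exists ((normD z).1 rz) (wn z rz).
  by exists I.
have [phi phiP] := choice ex; exists phi; split=> // z I SI eI.
have rz : root D z by apply/normD/(slice_value_eq0_qnorm SI)/valE.
have [Sphi ephi] := phiP z rz; split=> //.
by apply: (slice_zero_unique (wn z rz) SI); apply/valE.
Qed.

(** Sorting the $d$ distinct roots by the sign of their imaginary part: every
non-real quaternion is $\alpha + I \beta$ for a unique $I$ with $\beta > 0$ and for a
unique $I$ with $\beta < 0$, so roots above and below the real axis parametrize
the fibres of $P$ and of the companion. *)
Lemma fiber_cardinals a b (P Pv : H -> H) (g h gh hh : {poly C}) q d :
    slice_decomposition a b P -> slice_decomposition b a Pv ->
    twistor_polys P g h gh hh ->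
    separable_poly (twistor_poly g h gh hh q) ->
    size (twistor_poly g h gh hh q) = d.+1 ->
  exists m n k : nat, [/\ (fiber P q #= `I_m)%card, (fiber Pv q #= `I_n)%card,
    (real_fiber P q #= `I_k)%card & (m + n + k = d)%N].
Proof.
move=> dP dPv tP sep sD; have [phi [phi_root root_phi]] := root_point dP tP sep.
set D := twistor_poly g h gh hh q in sep sD phi_root root_phi.
have [rs Drs] := closed_field_poly_normal D.
have D0 : D != 0 by rewrite -size_poly_gt0 sD.
have rootD z : root D z = (z \in rs).
  by rewrite Drs rootZ ?lead_coef_eq0 // root_prod_XsubC.
have urs : uniq rs.
  move: sep; rewrite Drs (eqp_separable (eqp_scale _ _)) ?lead_coef_eq0 //.
  by rewrite separable_prod_XsubC.
have srs : size rs = d.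
  by apply: succn_inj; rewrite -sD Drs size_scale ?lead_coef_eq0 // size_prod_XsubC.
pose part (Q : R -> bool) := [seq z <- rs | Q (complex.Im z)].
have upart Q : uniq (part Q) by exact: filter_uniq.
have mem_part Q z : z \in part Q -> root D z /\ Q (complex.Im z).
  by rewrite mem_filter -rootD => /andP[].
have part_mem (Q : R -> bool) z : root D z -> Q (complex.Im z) -> z \in part Q.
  by move=> rz Qz; rewrite mem_filter Qz -rootD.
exists (size (part (fun t => 0 < t))), (size (part (fun t => t < 0))).
exists (size (part (fun t => t == 0))); split.
- apply: (@card_eq_seq_image _ _ 0 _ _ (fun z => to_slice (phi z) z)) => //.
    move=> z z' /mem_part[/phi_root[Sz _] z0] /mem_part[/phi_root[Sz' _] z0'].
    exact: to_slice_inj_upper.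
  move=> x; split=> [[xnr Px]|[z /mem_part[/phi_root[Sz ez] z0] <-]].
    have [I [z [SI z0 xE]]] := nonreal_to_slice xnr.
    move: Px; rewrite xE (decomposition_upper dP SI z0) => /(root_phi z I SI)[rz IE].
    by exists z; [exact: part_mem | rewrite IE].
  split; last by rewrite (decomposition_upper dP Sz z0).
  by apply: to_slice_nonreal => //; rewrite gt_eqF.
- have JE z : z^*^* = z by rewrite conjcK.
  have ImJ z : complex.Im z^* = - complex.Im z by case: z.
  apply: (@card_eq_seq_image _ _ 0 _ _ (fun z => to_slice (phi z) z)) => //.
    move=> z z' /mem_part[/phi_root[Sz _] z0] /mem_part[/phi_root[Sz' _] z0'].
    rewrite !(to_sliceJ (phi _)).
    move=> /(to_slice_inj_upper (unit_sphereN Sz) (unit_sphereN Sz')).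
    by rewrite !ImJ !oppr_gt0 => /(_ z0 z0') /(congr1 (@conjc R)); rewrite !JE.
  move=> x; split=> [[xnr Px]|[z /mem_part[/phi_root[Sz ez] z0] <-]].
    have [J [z [SJ z0 xE]]] := nonreal_to_slice xnr.
    have SI := unit_sphereN SJ; have z0' : complex.Im z^* < 0.
      by rewrite ImJ oppr_lt0.
    rewrite to_sliceJ in xE; move: Px.
    rewrite xE (decomposition_lower dPv SI z0') => /(root_phi _ _ SI)[rz IE].
    by exists z^*; [exact: part_mem | rewrite IE].
  split; last by rewrite (decomposition_lower dPv Sz z0).
  by apply: to_slice_nonreal => //; rewrite lt_eqF.
- have realE z : complex.Im z == 0 -> (complex.Re z)%:C = z.
    by case: z => s t /= /eqP->.
  apply: (@card_eq_seq_image _ _ 0 _ _ (fun z => (phi z, complex.Re z))) => //.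
    move=> z z' /mem_part[_ /realE z0] /mem_part[_ /realE z0'] [_ e].
    by rewrite -z0 -z0' e.
  move=> [I alpha]; split=> [[/= SI]|[z /mem_part[/phi_root[Sz ez] /realE z0] [<- <-]]].
    rewrite (real_extensionE alpha dP SI) => /(root_phi _ _ SI)[rz IE].
    by exists alpha%:C; [exact: part_mem | rewrite -IE].
  by split=> //=; rewrite (real_extensionE _ dP Sz) z0.
rewrite -srs /part !size_filter.
elim: {urs srs Drs rootD part upart mem_part part_mem} rs => //= z rs <-.
by case: ltrgt0P => _ /=; rewrite !(addn0, add0n, addnS, addSn, addn1, add1n).
Qed.

End TwistorDegree.

Theorem theorem1p4 (R : realType) (P Pv : quat R -> quat R) (d : nat) :
  slice_polynomial P ->
  ~ slice_constant (@nonreal R) P ->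
  is_companion P Pv ->
  is_twistor_degree P d ->
  exists Z : set (quat R),
    [/\ real_zariski_closed Z, Z <> setT &
        forall q : quat R, ~ Z q ->
          exists a b c : nat,
            [/\ (fiber P q #= `I_a)%card, (fiber Pv q #= `I_b)%card,
                (real_fiber P q #= `I_c)%card & (a + b + c = d)%N]].
Proof.
move=> _ nconst [a [b [dP dPv]]] [g [h [gh [hh [tP [q0 q0d] le_d]]]]].
have d0 : (0 < d)%N.
  have [q] := twistor_degree_gt0 dP tP nconst; move: (le_d q).
  by case: (size _) => [|[|n]] //= nd _; exact: leq_trans nd.
have size_le q : (size (twistor_poly g h gh hh q) <= d.+1)%N.
  by move: (le_d q); case: (size _).
have i0 : 'i != 0 :> R[i] by rewrite eq_complex /= oner_eq0 andbF.
have [||p [s ps] pP] := @generic_quadric_separable _ 'i g h gh hh i0 d d0.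
- move=> s; pose q : quat R := \row_k (s k)%:R.
  have -> : (fun i => (s i)%:R) = (fun k => (q 0 k)%:C).
    by apply: funext => k; rewrite mxE rmorph_nat.
  by rewrite -twistor_polyE.
- exists (fun k => (q0 0 k)%:C); rewrite -twistor_polyE.
  have e : size (twistor_poly g h gh hh q0) = d.+1.
    by move: q0d d0; case: (size _) => [<-|n /= ->].
  have := lead_coef_eq0 (twistor_poly g h gh hh q0).
  by rewrite lead_coefE e /= => ->; rewrite -size_poly_gt0 e.
have [pr [pi prE]] := mpoly_Re_Im p.
pose Z := [set q : quat R | forall p', [set pr; pi] p' -> meval (q 0) p' = 0].
have ZE q : Z q <-> meval (fun k => (q 0 k)%:C) p = 0.
  rewrite prE; split=> [Zq|[er ei] p' [->|->]] //.
  by rewrite !Zq; [|right|left].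
exists Z; split; first by exists [set pr; pi].
  pose q : quat R := \row_k (s k)%:R => ZT.
  have /ZE : Z q by rewrite ZT.
  move/eqP; apply/negP; move: ps; congr (_ != 0); apply: meval_eq => k.
  by rewrite mxE rmorph_nat.
move=> q nZ; have /pP : meval (fun k => (q 0 k)%:C) p != 0 by apply/eqP => /ZE.
by rewrite -twistor_polyE => -[sD sep]; exact: fiber_cardinals dP dPv tP sep sD.
Qed.
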